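(* Let $n$ be a positive integer and $\mathfrak{g}=A_{n-1}^+$. Then for any $f\in\mathfrak{g}^*$, $$\dim\Omega_f\le\begin{cases}\frac12(n-2)n & \text{if } n \text{ is even},\\ \frac12(n-1)^2 & \text{if } n\text{ is odd}.\end{cases}$$
   Context: $A_{n-1}^+$ is the Lie algebra of strictly upper triangular $n\times n$ complex matrices. The group $G=\exp(\mathfrak{g})$ of unitriangular $n\times n$ complex matrices acts on $\mathfrak{g}^*$ by the coadjoint action $(g.f)(x)=f(g^{-1}xg)$. For $f\in\mathfrak{g}^*$, $\Omega_f$ denotes the $G$-orbit (coadjoint orbit) of $f$; its dimension (as an algebraic variety) equals $\dim\mathfrak{g}-\dim\mathfrak{g}^f$, where $\mathfrak{g}^f=\{x\in\mathfrak{g}: f([x,y])=0\ \forall y\in\mathfrak{g}\}$. *)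

(* Defs.v *)
From HB Require Import structures.
From mathcomp Require Import all_boot all_order all_algebra.
From mathcomp Require Import boolp classical_sets reals constructive_ereal ereal.
From mathcomp Require Import complex.
From mathcomp Require mpoly.

Set Implicit Arguments.
Unset Strict Implicit.
Unset Printing Implicit Defensive.

Import Order.TTheory GRing.Theory Num.Theory.

Local Open Scope classical_set_scope.
Local Open Scope ring_scope.

Section Coadjoint.
Variables (F : fieldType) (n : nat).

Definition strict_upper : {vspace 'M[F]_n} :=
  <<[seq delta_mx p.1 p.2 | p <- enum [pred p : 'I_n * 'I_n | (p.1 < p.2)%N]]>>%VS.

Definition unitriangular (u : 'M[F]_n) : bool :=
  [forall i : 'I_n, forall j : 'I_n,
    (j <= i)%N ==> (u i j == (i == j)%:R)].

(* The linear dual; [F^o] is F as a vector space over itself. *)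
Definition strict_upper_dual := 'Hom(subvs_of strict_upper, F^o).

(* (u.f)(x) = f(u^-1 x u).  The casts [vsproj] and [linfun] lose nothing when
   u is unitriangular: see [coadjE]. *)
Definition coadj (u : 'M[F]_n) (f : strict_upper_dual) : strict_upper_dual :=
  linfun (fun x : subvs_of strict_upper =>
            f (vsproj strict_upper (invmx u *m vsval x *m u))).

Definition coadj_orbit (f : strict_upper_dual) : set strict_upper_dual :=
  [set h | exists2 u, unitriangular u & h = coadj u f].

Lemma strict_upperP (x : 'M[F]_n) :
  reflect (forall i j : 'I_n, (j <= i)%N -> x i j = 0) (x \in strict_upper).
Proof.
apply: (iffP idP) => [/coord_span -> i j le_ji | x0].
  rewrite summxE big1 // => k _; rewrite mxE.
  have k_lt := ltn_ord k; rewrite [X in (_ < X)%N]cardE in k_lt.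
  rewrite -(size_map (fun p => delta_mx p.1 p.2 : 'M[F]_n)) in k_lt.
  have /mapP[p] := mem_nth 0 k_lt.
  rewrite mem_enum inE => lt_p ->; rewrite mxE.
  case: eqP => [eq_i|_]; last by rewrite mulr0.
  case: eqP => [eq_j|_]; last by rewrite mulr0.
  by move: lt_p; rewrite -eq_i -eq_j ltnNge le_ji.
rewrite [x]matrix_sum_delta; apply: memv_suml => i _; apply: memv_suml => j _.
have [le_ji | lt_ij] := leqP j i; first by rewrite x0 // scale0r mem0v.
apply/memvZ/memv_span/mapP; exists (i, j) => //.
by rewrite mem_enum inE.
Qed.

Lemma unitriangularP (u : 'M[F]_n) :
  reflect (forall i j : 'I_n, (j <= i)%N -> u i j = (i == j)%:R)
          (unitriangular u).
Proof.
apply: (iffP forallP) => [H i j le_ji | H i].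
  by have /forallP/(_ j)/implyP/(_ le_ji)/eqP := H i.
by apply/forallP => j; apply/implyP => le_ji; apply/eqP/H.
Qed.

Lemma unitriangular_unit (u : 'M[F]_n) : unitriangular u -> u \in unitmx.
Proof.
move=> /unitriangularP uU; rewrite unitmxE -det_tr det_trig.
  by rewrite big1 ?unitr1 // => i _; rewrite mxE uU ?eqxx.
apply/is_trig_mxP => i j lt_ij; rewrite mxE uU ?(ltnW lt_ij) //.
by case: eqP lt_ij => // ->; rewrite ltnn.
Qed.

Lemma strict_upper_conj (u x : 'M[F]_n) :
  unitriangular u -> x \in strict_upper ->
  invmx u *m x *m u \in strict_upper.
Proof.
move=> uU /strict_upperP x0; have uV := unitriangular_unit uU.
move/unitriangularP: uU => uU; set y := _ *m u.
have uy : u *m y = x *m u by rewrite /y !mulmxA mulmxV // mul1mx.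
apply/strict_upperP => i j.
have [m] := ubnP (n - i); elim: m i => // m IHm i lt_m le_ji.
have xu0 : (x *m u) i j = 0.
  rewrite mxE big1 // => k _; have [le_ki|lt_ik] := leqP k i.
    by rewrite x0 ?mul0r.
  have lt_jk := leq_ltn_trans le_ji lt_ik; rewrite uU ?(ltnW lt_jk) //.
  by case: eqP lt_jk => [->|_ _]; rewrite ?ltnn ?mulr0.
move: xu0; rewrite -uy mxE (bigD1 i) //= uU // eqxx mul1r big1 ?addr0 // => k ne_ki.
have [le_ki|lt_ik] := leqP k i.
  by rewrite uU // eq_sym (negPf ne_ki) mul0r.
rewrite (IHm k) ?mulr0 // ?(leq_trans le_ji (ltnW lt_ik)) //.
by rewrite -ltnS (leq_trans _ lt_m) // ltnS ltn_sub2l // (ltn_trans lt_ik).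
Qed.

Lemma coadjE (u : 'M[F]_n) (f : strict_upper_dual)
    (x y : subvs_of strict_upper) :
  unitriangular u -> vsval y = invmx u *m vsval x *m u -> coadj u f x = f y.
Proof.
move=> uU eq_y.
pose g (x : subvs_of strict_upper) : F^o :=
  f (vsproj strict_upper (invmx u *m vsval x *m u)).
have g_lin : linear g.
  move=> a v w; rewrite /g [vsval _]linearP /= mulmxDr mulmxDl.
  rewrite -scalemxAr -scalemxAl.
  by rewrite !linearP.
pose gL := GRing.isLinear.Build _ _ _ _ g g_lin.
pose gM : {linear _ -> _} := HB.pack g gL.
rewrite /coadj -[linfun _]/(linfun gM) lfunE /= /g -eq_y; congr (f _).
exact: vsvalK.
Qed.

End Coadjoint.

Section ZariskiDimension.
Variables (R : realType) (V : vectType R[i]).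

Definition poly_eval (p : mpoly.mpoly (\dim {:V}) R[i]) (v : V) : R[i] :=
  mpoly.meval (fun i => coord (vbasis {:V}) i v) p.

Definition zero_locus (S : set (mpoly.mpoly (\dim {:V}) R[i])) : set V :=
  [set v | forall p, S p -> poly_eval p v = 0].

Definition zariski_closed (Z : set V) : Prop := exists S, Z = zero_locus S.

Definition closed_in (X Z : set V) : Prop :=
  exists2 A, zariski_closed A & Z = X `&` A.

Definition irreducible (Z : set V) : Prop :=
  Z !=set0 /\ forall A B, zariski_closed A -> zariski_closed B ->
    Z `<=` A `|` B -> Z `<=` A \/ Z `<=` B.

Definition irreducible_chain (X : set V) (k : nat) (Z : nat -> set V) : Prop :=
  (forall i, (i <= k)%N -> closed_in X (Z i) /\ irreducible (Z i)) /\
  (forall i, (i < k)%N -> Z i `<` Z i.+1).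

(* Krull dimension of X with the topology induced by the Zariski topology of
   V; it is -oo for the empty set. *)
Definition zariski_dim (X : set V) : \bar R :=
  ereal_sup [set (k%:R)%:E | k in [set k | exists Z, irreducible_chain X k Z]].

End ZariskiDimension.

(* Main.v *)
Require Import Defs.
From HB Require Import structures.
From mathcomp Require Import all_boot all_order all_algebra.
From mathcomp Require Import boolp classical_sets reals constructive_ereal ereal.
From mathcomp Require Import complex.
From mathcomp Require mpoly.
Import -(notations) mpoly.
From mathcomp Require Import zify ring.
Import Order.TTheory GRing.Theory Num.Theory.
Local Open Scope ring_scope.

(** Write [f] as [x |-> \tr (F *m x)]; only the strictly lower part of [F]
    matters, and [u] sends [F] to [u *m F *m invmx u]
    ([coadj_trace_form]).  Cut the indices at [p], the integer part of [n / 2],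
    and set [q = n - p].  The lower left [q] by [p] block of [u F u^-1] involves
    only that block [B] of [F]: it equals [a B c] with [a] the lower right block
    of [u] and [c] the upper left block of [u^-1], both unitriangular.  So the
    corner is described by the strictly upper entries of [a] and [c],
    [q(q-1)/2 + p(p-1)/2] of them, instead of its own [pq] entries.  The other
    strictly lower entries lie in the two diagonal blocks and number again
    [p(p-1)/2 + q(q-1)/2].  Hence the orbit lies in the image of a polynomial
    map from an affine space of dimension [p(p-1) + q(q-1)]
    ([coadj_orbit_parametrized]), and this number is the bound, for either
    parity of [n].

    It remains to see that a subset [X] of the image of a polynomial map from
    affine [d]-space has Krull dimension at most [d]
    ([zariski_dim_parametrized]).  Given a chain [Z 0 < ... < Z k] of
    irreducible closed subsets of [X], choose polynomials [g i] that vanish on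
    [Z i] but not on [Z i.+1].  By induction on [i], the [m ^ i] monomials in
    [g 0, ..., g i.-1] with exponents below [m] are linearly independent
    functions on [Z i]: in a relation on [Z i.+1], restricting to [Z i] kills
    all but the terms without [g i], so these have zero coefficients, and then
    one can divide by [g i] because [Z i.+1] is irreducible
    ([free_on_powers]).  Pulled back to the affine space, these functions are
    polynomials in [d] variables of degree [O(m)], a space of dimension
    [O(m ^ d)].  For [i = d + 1] and large [m] this is absurd. *)

Local Notation msize p := (mmeasure mdeg p).

(** * Counting linearly independent polynomials of bounded degree *)

(** A crude bound suffices, as only the exponent of [N] matters: each of the [d]
    exponents of a monomial of degree less than [N] is itself less than [N]. *)
Lemma card_bmultinom (d N : nat) : (#|{: bmultinom d N}| <= N ^ d)%N.
Proof.
case: N => [|N].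
  by rewrite eq_card0 // => b; have := valP b; rewrite ltn0.
pose digits (b : bmultinom d N.+1) : {ffun 'I_d -> 'I_N.+1} :=
  [ffun i => inord (bmnm b i)].
have digits_inj : injective digits.
  move=> b b' /ffunP eq_bb'; apply/val_inj/mnmP => i.
  have small (a : bmultinom d N.+1) : (bmnm a i < N.+1)%N.
    apply: leq_ltn_trans (valP a); rewrite mdegE (bigD1 i) //=.
    exact: leq_addr.
  have /(congr1 val) := eq_bb' i.
  by rewrite !ffunE /= !inordK.
by have := leq_card _ digits_inj; rewrite card_ffun !card_ord.
Qed.

Lemma card_free_mpoly (K : fieldType) (d N : nat) (E : finType)
    (P : E -> mpoly d K) :
    (forall e, msize (P e) <= N)%N ->
    (forall c : E -> K, \sum_e c e *: P e = 0 -> forall e, c e = 0) ->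
  (#|E| <= N ^ d)%N.
Proof.
move=> szP freeP; apply: leq_trans (card_bmultinom d N).
pose mon (b : 'I_#|{: bmultinom d N}|) := bmnm (enum_val b).
(* The rows of [A] are the coefficient vectors of the [P e]; more rows than
   columns would give a linear relation, a row vector [v] in the kernel. *)
pose A : 'M[K]_(#|E|, #|{: bmultinom d N}|) :=
  \matrix_(i, b) mcoeff (mon b) (P (enum_val i)).
suff /eqP <- : row_free A by exact: rank_leq_col.
rewrite -kermx_eq0; apply/negPn/negP => /rowV0Pn[v /sub_kermxP vA0] /eqP[].
pose c e := v 0 (enum_rank e).
have c0 : \sum_e c e *: P e = 0.
  under eq_bigr => e _ do rewrite (mpolywE (szP e)) scaler_sumr.
  rewrite exchange_big big1 //= => b _.
  under eq_bigr => e _ do rewrite scalerA.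
  rewrite -scaler_suml (_ : \sum_e _ = 0) ?scale0r //.
  transitivity ((v *m A) 0 (enum_rank b)); last by rewrite vA0 mxE.
  rewrite mxE [RHS](reindex (@enum_rank E)) /=; last exact/onW_bij/enum_rank_bij.
  by apply: eq_bigr => e _; rewrite mxE /mon !enum_rankK.
by apply/rowP => i; rewrite mxE -(enum_valK i); exact: freeP c0 _.
Qed.

Lemma msizeM_le_pred (K : fieldType) d (p q : mpoly d K) a b :
  (msize p <= a.+1)%N -> (msize q <= b.+1)%N -> (msize (p * q) <= (a + b).+1)%N.
Proof.
have [->|p0] := eqVneq p 0; first by rewrite mul0r mmeasure0.
have [->|q0] := eqVneq q 0; first by rewrite mulr0 mmeasure0.
rewrite msizeM //; move: (msize p) (msize q) => s t; lia.
Qed.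

Lemma msizeX_le (K : fieldType) d (p : mpoly d K) a n :
  (msize p <= a.+1)%N -> (msize (p ^+ n) <= (n * a).+1)%N.
Proof.
move=> szp; elim: n => [|n IHn]; first by rewrite expr0 msize1.
by rewrite exprS mulSn msizeM_le_pred.
Qed.

(** * Krull dimension of polynomially parametrized sets *)

Section KrullDimension.
Variables (R : realType) (V : vectType R[i]).
Local Notation polyV := (mpoly (\dim {:V}) R[i]).
Implicit Types (X Z A : set V) (p q : polyV).

Definition free_on Z (E : finType) (phi : E -> polyV) : Prop :=
  forall c : E -> R[i],
    (forall z, Z z -> \sum_e c e * poly_eval (phi e) z = 0) ->
  forall e, c e = 0.

(** The polynomial functions on an irreducible set form an integral domain. *)
Lemma irreducible_mul_eq0 Z p q :
    irreducible Z -> (forall z, Z z -> poly_eval p z * poly_eval q z = 0) ->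
    (exists2 z, Z z & poly_eval p z != 0) ->
  forall z, Z z -> poly_eval q z = 0.
Proof.
move=> [_ irrZ] pq0 [y Zy py].
have locus (r : polyV) : zariski_closed (zero_locus [set r]%classic).
  by exists [set r]%classic.
have [z Zz|Zp|Zq] := irrZ _ _ (locus p) (locus q).
- by have /eqP := pq0 z Zz; rewrite mulf_eq0 => /orP[]/eqP r0;
    [left|right] => _ ->.
- by rewrite (Zp y Zy p) ?eqxx in py.
- by move=> z Zz; exact: (Zq z Zz).
Qed.

(** The inductive step of algebraic independence along a chain: [g] is a new
    element, zero on [Z] and not on [Z'].  A relation [h 0 + h 1 g + ... = 0] on
    [Z'] becomes [h 0 = 0] on [Z], whence the coefficients of [h 0] vanish; what
    remains is divisible by [g], which can be cancelled on [Z']. *)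
Lemma free_on_powers Z Z' (E : finType) (phi : E -> polyV) g m :
    irreducible Z' -> (Z `<=` Z')%classic ->
    (forall z, Z z -> poly_eval g z = 0) ->
    (exists2 z, Z' z & poly_eval g z != 0) ->
    free_on Z E phi ->
  free_on Z' (E * 'I_m)%type (fun ej => phi ej.1 * g ^+ ej.2).
Proof.
move=> irrZ' sZZ' g0 gN0 free c.
pose h (b : E -> R[i]) : polyV := \sum_e b e *: phi e.
have hE b z : poly_eval (h b) z = \sum_e b e * poly_eval (phi e) z.
  rewrite /poly_eval /h raddf_sum /=.
  by apply: eq_bigr => e _; exact: mevalZ.
have step : forall k (b : nat -> E -> R[i]),
    (forall z, Z' z ->
       poly_eval (\sum_(j < k) h (b j) * g ^+ j) z = 0) ->
    forall j, (j < k)%N -> forall e, b j e = 0.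
  elim=> // k IHk b rel0.
  pose q := \sum_(j < k) h (b j.+1) * g ^+ j.
  have relE z : poly_eval (\sum_(j < k.+1) h (b j) * g ^+ j) z =
      poly_eval (h (b 0%N)) z + poly_eval g z * poly_eval q z.
    rewrite big_ord_recl expr0 mulr1 /poly_eval raddfD -rmorphM; congr (_ + _).
    congr (meval _ _); rewrite /q mulr_sumr; apply: eq_bigr => j _.
    by rewrite lift0 exprS mulrCA.
  have b0 e : b 0%N e = 0.
    apply: free e => z Zz; rewrite -hE -(rel0 z (sZZ' z Zz)) relE g0 //.
    by rewrite mul0r addr0.
  have h0 z : poly_eval (h (b 0%N)) z = 0.
    by rewrite hE big1 // => e _; rewrite b0 mul0r.
  (* Divide the remaining relation by [g] and shift the coefficients. *)
  case=> [//|j] lt_jk; apply: (IHk (fun j => b j.+1)) lt_jk.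
  apply: (irreducible_mul_eq0 _ _ _ irrZ' _ gN0) => z Zz.
  by have := rel0 z Zz; rewrite relE h0 add0r.
move=> rel0 [e j].
case: m c rel0 j => [|m] c rel0 j; first by case: j.
have -> : c (e, j) = (fun i e => c (e, inord i)) (val j) e.
  by rewrite /= inord_val.
apply: (step _ (fun i e => c (e, inord i)) _ _ (ltn_ord j)) => z Zz.
rewrite -[RHS](rel0 z Zz).
transitivity (\sum_(i < m.+1) \sum_e c (e, i) * poly_eval (phi e * g ^+ i) z).
  rewrite /poly_eval raddf_sum /=; apply: eq_bigr => i _.
  rewrite mevalM -/(poly_eval _ _) hE mulr_suml; apply: eq_bigr => e' _.
  by rewrite inord_val /poly_eval [in RHS]mevalM mulrA.
rewrite exchange_big pair_bigA /=.
by apply: eq_bigr => -[].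
Qed.

(** The set [X] only has to be contained in the image of [psi]. *)
Definition parametrized X (d : nat)
    (psi : (\dim {:V}).-tuple (mpoly d R[i])) : Prop :=
  forall v, X v ->
    exists x, forall i, coord (vbasis {:V}) i v = meval x (tnth psi i).

(** Composition with [psi] turns independent functions on [X] into independent
    polynomials, since a relation between the latter holds at every parameter. *)
Lemma card_free_on_parametrized X d psi N (E : finType) (phi : E -> polyV) :
    parametrized X d psi ->
    (forall e, msize (comp_mpoly psi (phi e)) <= N)%N ->
    free_on X E phi ->
  (#|E| <= N ^ d)%N.
Proof.
move=> param szphi free; apply: card_free_mpoly szphi _ => c c0.
apply: free => v Xv; have [x xE] := param v Xv.
rewrite -[RHS](meval0 x) -c0 raddf_sum /=; apply: eq_bigr => e _.
by rewrite mevalZ comp_mpoly_meval; congr (_ * _); exact: meval_eq.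
Qed.

Lemma irreducible_chain_separate X k (Z : nat -> set V) i :
    irreducible_chain X k Z -> (i < k)%N ->
  exists g : polyV, (forall z, Z i z -> poly_eval g z = 0) /\
    exists2 z, Z i.+1 z & poly_eval g z != 0.
Proof.
move=> [chZ ltZ] lt_ik.
have [[_ [S ->] ZiE] _] := chZ i (ltnW lt_ik).
have [[A _ ZSE] _] := chZ i.+1 lt_ik.
have [sZ /(_ _)] := ltZ i lt_ik.
move=> nsub; apply: contrapT => noG; apply: nsub => z Zz.
have Xz : X z by move: Zz; rewrite ZSE => -[].
rewrite ZiE; split=> // p Sp; apply/eqP/negPn/negP => pz.
apply: noG; exists p; split; last by exists z.
by move=> y; rewrite ZiE => -[_ /(_ p Sp)].
Qed.

(** The factor [D] bounds the degrees of the separating polynomials after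
    composition with [psi].  It has to be independent of [m], so that the degrees
    of the [m ^ i] independent functions grow only linearly in [m]. *)
Lemma free_on_chain X k (Z : nat -> set V) d
    (psi : (\dim {:V}).-tuple (mpoly d R[i])) :
    irreducible_chain X k Z ->
  exists D, forall m i, (i <= k)%N ->
    exists (E : finType) (phi : E -> polyV),
      [/\ #|E| = (m ^ i)%N, free_on (Z i) E phi &
          forall e, (msize (comp_mpoly psi (phi e)) <= (i * (m * D)).+1)%N].
Proof.
move=> chain; have [chZ ltZ] := chain.
have /choice[g gP] i : exists g : polyV, (i < k)%N ->
    (forall z, Z i z -> poly_eval g z = 0) /\
    exists2 z, Z i.+1 z & poly_eval g z != 0.
  have [lt_ik|] := boolP (i < k)%N; last by exists 0.
  by have [g gP] := irreducible_chain_separate _ _ _ _ chain lt_ik; exists g.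
pose D := \max_(i < k) msize (comp_mpoly psi (g i)).
exists D => m; elim=> [|i IHi] le_ik.
  have [_ [[z Zz] _]] := chZ 0%N isT.
  exists unit, (fun=> 1); split=> [|c c0 []|_].
  - by rewrite card_unit expn0.
  - have := c0 z Zz; rewrite (big_pred1 tt) => [|[]] //.
    by rewrite /poly_eval meval1 mulr1.
  - by rewrite comp_mpoly1 msize1.
have [E [phi [cardE free szphi]]] := IHi (ltnW le_ik).
have [_ irrZ] := chZ _ le_ik; have [sZ _] := ltZ _ le_ik.
have [g0 gN0] := gP _ le_ik.
exists (E * 'I_m)%type, (fun ej : E * 'I_m => phi ej.1 * g i ^+ ej.2); split.
- by rewrite card_prod cardE card_ord expnSr.
- exact: free_on_powers irrZ sZ g0 gN0 free.
move=> [e j] /=; rewrite rmorphM rmorphXn /= mulSn addnC.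
apply: msizeM_le_pred (szphi e) _.
have szg : (msize (comp_mpoly psi (g i)) <= D.+1)%N.
  by apply/leqW; exact: (leq_bigmax (Ordinal le_ik)).
apply: leq_trans (msizeX_le _ _ _ _ j szg) _.
by rewrite ltnS leq_mul2r (ltnW (ltn_ord j)) orbT.
Qed.

Lemma zariski_dim_parametrized X d psi :
  parametrized X d psi -> (zariski_dim X <= d%:R%:E)%E.
Proof.
move=> param; apply: ge_ereal_sup => _ [k [Z chain] <-].
rewrite lee_fin ler_nat leqNgt; apply/negP => lt_dk.
have [D freeZ] := free_on_chain _ _ _ d psi chain.
(* Take [m = C ^ d + 1].  The degree bound [d.+1 * (m * D) + 1] is at most
   [C * m], and [(C * m) ^ d < m ^ d.+1]. *)
pose C := (d.+1 * D).+1.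
have [E [phi [cardE free szphi]]] := freeZ (C ^ d).+1 _ lt_dk.
have sub v : Z d.+1 v -> X v by case: chain => /(_ _ lt_dk)[[A _ ->] _] _ [].
have paramZ : parametrized (Z d.+1) d psi by move=> v /sub; exact: param.
have := card_free_on_parametrized _ _ _ _ _ _ paramZ szphi free.
rewrite cardE leqNgt => /negP; apply.
apply: (@leq_ltn_trans ((C * (C ^ d).+1) ^ d)); last first.
  by rewrite expnMn expnS ltn_pmul2r ?expn_gt0.
have [->|d_gt0] := posnP d; first by [].
rewrite leq_exp2r // /C; move: (_ ^ d)%N => M; nia.
Qed.
End KrullDimension.

(** * The coadjoint action in terms of matrices *)

Section TracePairing.
Variables (K : fieldType) (n : nat).
Implicit Types (M N u : 'M[K]_n).

Definition trace_form M : strict_upper_dual K n :=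
  linfun (fun x : subvs_of (strict_upper K n) => \tr (M *m vsval x) : K^o).

Lemma trace_formE M x : trace_form M x = \tr (M *m vsval x).
Proof.
pose t (x : subvs_of (strict_upper K n)) : K^o := \tr (M *m vsval x).
have t_lin : linear t.
  by move=> a v w; rewrite /t [vsval _]linearP linearP linearP.
pose tL := GRing.isLinear.Build _ _ _ _ t t_lin.
pose tM : {linear _ -> _} := HB.pack t tL.
by rewrite /trace_form -[linfun _]/(linfun tM) lfunE.
Qed.

Lemma trace_form_is_linear : linear trace_form.
Proof.
move=> a M N; apply/lfunP => x.
by rewrite add_lfunE scale_lfunE !trace_formE mulmxDl -scalemxAl linearP.
Qed.
HB.instance Definition _ :=
  GRing.isLinear.Build K 'M[K]_n (strict_upper_dual K n) _ trace_form
    trace_form_is_linear.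

(** The matrix is read off from an extension of [f] to all matrices, here through
    a projection onto the strictly upper triangular ones. *)
Lemma trace_form_surj (f : strict_upper_dual K n) : exists M, f = trace_form M.
Proof.
pose g (x : 'M[K]_n) := f (vsproj (strict_upper K n) x).
exists (\matrix_(i, j) g (delta_mx j i)); apply/lfunP => x.
rewrite trace_formE -[x in LHS]vsvalK -/(g _) {1}[vsval x]matrix_sum_delta.
rewrite mxtrace_mulC /g !raddf_sum; apply: eq_bigr => i _.
rewrite mxE !raddf_sum; apply: eq_bigr => j _.
by rewrite /= !linearZ /= mxE.
Qed.

Lemma eq_trace_form M N :
    (forall i j : 'I_n, (j < i)%N -> M i j = N i j) ->
  trace_form M = trace_form N.
Proof.
move=> eqMN; apply/lfunP => x; rewrite !trace_formE.
have /strict_upperP x0 := subvsP x.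
apply: eq_bigr => i _; rewrite !mxE; apply: eq_bigr => j _.
by have [le_ij|/eqMN->//] := leqP i j; rewrite x0 // !mulr0.
Qed.

Lemma coadj_trace_form u M :
  unitriangular u -> coadj u (trace_form M) = trace_form (u *m M *m invmx u).
Proof.
move=> uU; apply/lfunP => x.
pose y := vsproj (strict_upper K n) (invmx u *m vsval x *m u).
have yE : vsval y = invmx u *m vsval x *m u.
  by rewrite vsprojK // strict_upper_conj // subvsP.
rewrite (coadjE _ uU yE) !trace_formE yE.
by rewrite !mulmxA mxtrace_mulC !mulmxA.
Qed.

(** Compare the entries of [u *m invmx u = 1] row by row from the bottom: the
    terms with [k > i] are already known to vanish. *)
Lemma unitriangular_invmx u : unitriangular u -> unitriangular (invmx u).
Proof.
move=> uU; have uV := mulmxV (unitriangular_unit uU).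
move/unitriangularP: uU => uU; apply/unitriangularP => i j.
have [m] := ubnP (n - i); elim: m i => // m IHm i lt_m le_ji.
have := congr1 (fun A : 'M_n => A i j) uV.
rewrite !mxE (bigD1 i) //= uU // eqxx mul1r big1 ?addr0 // => k ne_ki.
have [le_ki|lt_ik] := leqP k i.
  by rewrite uU // eq_sym (negPf ne_ki) mul0r.
rewrite (IHm k) ?(leq_trans le_ji (ltnW lt_ik)) //; last first.
  by rewrite -ltnS (leq_trans _ lt_m) // ltnS ltn_sub2l // (ltn_trans lt_ik).
by rewrite -val_eqE gtn_eqF ?mulr0 // (leq_ltn_trans le_ji).
Qed.

End TracePairing.

(** * A polynomial parametrization of coadjoint orbits *)

Section OrbitChart.
Variables (n p : nat).

(** The off-diagonal positions of the two diagonal blocks, of sizes [p] and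
    [n - p]; they index the parameters of the orbit. *)
Definition block_offdiag : pred ('I_n * 'I_n) :=
  fun ij => (ij.1 != ij.2) && ((ij.1 < p)%N == (ij.2 < p)%N).

Definition block_unitri (A : pzRingType) (y : 'M[A]_n) : 'M[A]_n :=
  \matrix_(i, j) if i == j then 1
                 else if (i < j)%N && block_offdiag (i, j) then y i j else 0.

(** In the two diagonal blocks a parameter below the diagonal is an entry of the
    resulting matrix, and one above the diagonal is an entry of the unitriangular
    factors of the corner.  One matrix [block_unitri A y] serves as both factors:
    being block diagonal, it acts on the left of the corner by its lower block
    and on the right by its upper block.  Only the strictly lower part of the
    result is meaningful. *)
Definition orbit_chart (A : pzRingType) (F y : 'M[A]_n) : 'M[A]_n :=
  \matrix_(i, j) if (p <= i)%N && (j < p)%N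
                 then (block_unitri A y *m F *m block_unitri A y) i j else y i j.

(** Used with evaluation of polynomials, so that the chart applied to a matrix of
    indeterminates gives the polynomials of the parametrization. *)
Lemma map_orbit_chart (A B : pzRingType) (h : {rmorphism A -> B}) F y :
  map_mx h (orbit_chart A F y) = orbit_chart B (map_mx h F) (map_mx h y).
Proof.
have mapU : map_mx h (block_unitri A y) = block_unitri B (map_mx h y).
  apply/matrixP => i j; rewrite !mxE.
  by case: ifP => _; [rewrite rmorph1 | case: ifP => _; rewrite ?rmorph0].
apply/matrixP => i j; rewrite [LHS]mxE [in LHS]mxE [in RHS]mxE -mapU -!map_mxM.
by rewrite ![map_mx _ _ _ _]mxE; case: ifP.
Qed.

(** In a row [i >= p], the nonzero entries of [u] are in columns [k >= i >= p],
    and in a column [j < p], those of [invmx u] are in rows [l <= j < p].  So for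
    the corner entries [u] can be replaced by its lower block and [invmx u] by
    its upper block. *)
Lemma orbit_chart_onto (K : fieldType) (F u : 'M[K]_n) :
    unitriangular u ->
  exists y : 'M[K]_n, (forall i j, ~~ block_offdiag (i, j) -> y i j = 0) /\
    forall i j : 'I_n, (j < i)%N ->
      orbit_chart K F y i j = (u *m F *m invmx u) i j.
Proof.
move=> uU; set N := u *m F *m invmx u.
have /unitriangularP vU := unitriangular_invmx _ _ _ uU.
move/unitriangularP: uU => uU.
exists (\matrix_(i, j) if ~~ block_offdiag (i, j) then 0 else
          if (j < i)%N then N i j
          else if (i < p)%N then invmx u i j else u i j).
split=> [i j offN|i j lt_ji]; first by rewrite mxE offN.
set y := matrix_of_fun _ _; rewrite mxE.
case: ifP => [/andP[le_pi lt_jp]|]; last first.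
  move=> notcorner; rewrite mxE lt_ji /block_offdiag /= -val_eqE gtn_eqF //=.
  case: eqP => //; lia.
have Urow k : block_unitri K y i k = u i k.
  rewrite mxE; have [<-|ne_ik] := eqVneq i k; first by rewrite uU ?eqxx.
  have [le_ki|lt_ik] /= := leqP k i; first by rewrite uU // (negPf ne_ik).
  rewrite mxE /block_offdiag /= ne_ik [(k < i)%N]ltnNge (ltnW lt_ik) /=.
  by rewrite !ltnNge le_pi (leq_trans le_pi (ltnW lt_ik)) eqxx.
have Ucol l : block_unitri K y l j = invmx u l j.
  rewrite mxE; have [->|ne_lj] := eqVneq l j; first by rewrite vU ?eqxx.
  have [le_jl|lt_lj] /= := leqP j l; first by rewrite vU // (negPf ne_lj).
  rewrite mxE /block_offdiag /= ne_lj [(j < l)%N]ltnNge (ltnW lt_lj) /=.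
  by rewrite lt_jp (ltn_trans lt_lj lt_jp) eqxx.
rewrite /N !mxE; apply: eq_bigr => l _; rewrite Ucol; congr (_ * _).
by rewrite !mxE; apply: eq_bigr => k _; rewrite Urow.
Qed.

Local Notation coord_index := {ij | block_offdiag ij}.

Definition generic_block_mx (K : fieldType) : 'M[mpoly #|{: coord_index}| K]_n :=
  \matrix_(i, j) if insub (i, j) is Some s then mpolyX K (mnm1 (enum_rank s))
                 else 0.

Lemma meval_generic_block_mx (K : fieldType) (y : 'M[K]_n) :
    (forall i j, ~~ block_offdiag (i, j) -> y i j = 0) ->
  exists x, map_mx (meval x) (generic_block_mx K) = y.
Proof.
move=> y0; exists (fun k => y (val (enum_val k)).1 (val (enum_val k)).2).
apply/matrixP => i j; rewrite !mxE.
case: insubP => [s _ sE|/y0->]; last by rewrite meval0.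
by rewrite mevalXU enum_rankK sE.
Qed.
End OrbitChart.

(** In a block of size [m], each of the [m] rows has [m.-1] off-diagonal
    positions. *)
Lemma card_block_offdiag n p q : n = (p + q)%N ->
  #|{: {ij | block_offdiag n p ij}}| = (p * p.-1 + q * q.-1)%N.
Proof.
move=> ->.
have offdiag m (i : 'I_m) : (\sum_(j < m) (i != j) = m.-1)%N.
  by rewrite -big_mkcond sum1_card /= -[m in RHS]card_ord -(cardC1 i);
     apply: eq_card => j; rewrite !inE eq_sym.
rewrite card_sig -sum1_card big_mkcond /=.
rewrite -(pair_bigA _ (fun i j => nat_of_bool (block_offdiag _ p (i, j)))) /=.
rewrite big_split_ord /=; congr (_ + _)%N.
  transitivity (\sum_(i < p) p.-1)%N; last by rewrite sum_nat_const card_ord.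
  apply: eq_bigr => i _.
  rewrite big_split_ord /= -(offdiag _ i) [X in (_ + X)%N]big1 ?addn0 => [|j _].
    apply: eq_bigr => j _.
    by rewrite /block_offdiag /= !ltn_ord eqxx andbT.
  by rewrite /block_offdiag /= ltn_ord ltnNge leq_addr andbF.
transitivity (\sum_(i < q) q.-1)%N; last by rewrite sum_nat_const card_ord.
apply: eq_bigr => i _.
rewrite big_split_ord /= -(offdiag _ i) big1 ?add0n => [|j _].
  apply: eq_bigr => j _.
  rewrite /block_offdiag /= !ltnNge !leq_addr eqxx andbT.
  by rewrite (inj_eq (@rshift_inj _ _)).
by rewrite /block_offdiag /= ltn_ord ltnNge leq_addr andbF.
Qed.

(** A linear form commutes with evaluation once its values on the matrix units
    are used as coefficients. *)
Lemma meval_linear_form (K : fieldType) (d n : nat)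
    (phi : {linear 'M[K]_n -> K^o}) (G : 'M[mpoly d K]_n) x :
  meval x (\sum_i \sum_j phi (delta_mx i j) *: G i j) =
  phi (map_mx (meval x) G).
Proof.
rewrite [map_mx _ _ in RHS]matrix_sum_delta.
rewrite !raddf_sum; apply: eq_bigr => i _; rewrite /= !raddf_sum.
by apply: eq_bigr => j _; rewrite /= mevalZ linearZ mxE mulrC.
Qed.

Lemma coadj_orbit_parametrized (R : realType) (n p : nat)
    (f : strict_upper_dual R[i] n) :
  exists psi,
    parametrized R _ (coadj_orbit f) #|{: {ij | block_offdiag n p ij}}| psi.
Proof.
have [F fE] := trace_form_surj _ _ f.
pose d := #|{: {ij | block_offdiag n p ij}}|.
pose G : 'M[mpoly d R[i]]_n :=
  orbit_chart n p _ (map_mx (@mpolyC d R[i]) F) (generic_block_mx n p R[i]).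
pose b := vbasis {:strict_upper_dual R[i] n}.
pose phi k : {linear 'M[R[i]]_n -> R[i]^o} := coord b k \o trace_form R[i] n.
exists [tuple \sum_i \sum_j phi k (delta_mx i j) *: G i j | k < _].
move=> _ [u uU ->]; rewrite fE coadj_trace_form //.
have [y [y0 yE]] := orbit_chart_onto n p _ F u uU.
have [x xE] := meval_generic_block_mx _ _ _ _ y0.
exists x => k; rewrite tnth_mktuple meval_linear_form map_orbit_chart xE.
have -> : map_mx (meval x) (map_mx (@mpolyC d R[i]) F) = F.
  by apply/matrixP => i j; rewrite !mxE mevalC.
by rewrite -(eq_trace_form _ _ _ _ yE).
Qed.

Theorem theorem7p5 (R : realType) (n : nat) (n_gt0 : (0 < n)%N)
    (f : strict_upper_dual R[i] n) :
  (zariski_dim (coadj_orbit f) <=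
   (if ~~ odd n then 2^-1 * (n%:R - 2) * n%:R
    else 2^-1 * (n%:R - 1) ^+ 2 : R)%:E)%E.
Proof.
have [psi /zariski_dim_parametrized/le_trans] :=
  coadj_orbit_parametrized R n n./2 f.
apply; rewrite lee_fin.
(* The blocks have sizes [n./2] and [n - n./2], and the bound is attained by the
   number of parameters in both cases. *)
rewrite (card_block_offdiag n n./2 (n./2 + odd n)) ?addnA ?addnn; last lia.
case: ifPn => [even_n|/negPn odd_n].
  have [m nE] : exists m, n = (m.+1 + m.+1)%N by exists (n./2).-1; lia.
  rewrite (negPf even_n) nE addnn doubleK -addnn addn0 /=.
  rewrite !natrD !natrM -natr1 le_eqVlt.
  by apply/orP; left; apply/eqP; field.
have [m nE] : exists m, n = m.*2.+1 by exists n./2; lia.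
rewrite odd_n nE /= uphalf_double addn1 /= -(natr1 m.*2) addrK.
have -> : (m * m.-1 + m.+1 * m = 2 * (m * m))%N by case: m {nE} => // m; lia.
by rewrite -mul2n !natrM le_eqVlt; apply/orP; left; apply/eqP; field.
Qed.
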